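(* Let $(M,g)$ be a $4$-dimensional Lorentzian manifold, and let $\mathcal H=\frac12 mc^2\left(1+\frac{g^{\mu\nu}p_\mu p_\nu}{m^2c^2}\right)+\Phi$ be the single-particle Hamiltonian, with $\gamma=\frac1c\frac{\partial\mathcal H}{\partial p_0}$, $\chi=c^2+g_{\mu\nu}\frac{\partial\mathcal H}{\partial p_\mu}\frac{\partial\mathcal H}{\partial p_\nu}$, and $\mathcal H$ speed of light compatible, i.e. $\{\chi,\mathcal H\}=0$. Assume that the metric and the averaged potential possess a coordinate-time Killing symmetry, $$\frac{\partial g}{\partial t}=0,\qquad \frac{\partial\Phi}{\partial t}=0,$$ and that collisions are $p_0$-grazing, so that the collision operator is the modified one, $\mathscr C_{\Sigma'}(f,f)$, described in the context (built from the tensor $J_{\Sigma'}$ obtained by projecting the canonical Poisson tensor on $\{\delta z: d\chi(\delta z)=0,\ dx^0(\delta z)=0,\ dp_0(\delta z)=0\}$). Let $\beta\in\mathbb R$, let $\zeta$ be a function of $p_0$, let $Z$ be a normalization constant, and set $$f_\infty=\frac1Z\,\gamma\,\delta(\chi)\,\exp\{-\beta\mathcal H\}\,\zeta(p_0),$$ where $\Phi=\int f_\infty(z')V(z,z')\,dz'$. Then $f_\infty$ is a thermodynamic equilibrium of the Landau--Einstein system with collision operator $\mathscr C_{\Sigma'}$, i.e. $$\left\{\frac{f_\infty}{\gamma},\mathcal H\right\}=0,\qquad \mathscr C_{\Sigma'}(f_\infty,f_\infty)=0,\qquad \frac{\partial f_\infty}{\partial t}=0,\qquad\frac{\partial g}{\partial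 t}=0 .$$
   Context: Coordinates: $x=(x^0,x^1,x^2,x^3)$ on $M$ with $x^0=ct$, $t$ the coordinate-time; $p=(p_0,p_1,p_2,p_3)$ the canonical momenta; $z=(x,p)\in T^*M$; $\boldsymbol x=(x^1,x^2,x^3)$; $dz=dx\,dp$, $dV=d\boldsymbol x\,dp=dx^1dx^2dx^3dp_0dp_1dp_2dp_3$. Signature $(-,+,+,+)$. Fields are assumed regular enough, and integrals convergent enough, for the expressions to make sense. $m,c>0$ are constants. Upper case indices run over the $8$ phase space coordinates. A prime on a quantity denotes evaluation at a second phase space point $z'$ (for quantities depending on $(z,z')$, the prime denotes exchange of $z$ and $z'$). $J_c$ is the canonical Poisson tensor and $\{F,G\}=\frac{\partial}{\partial z^A}\left(J_c^{AB}\frac{\partial G}{\partial z^B}F\right)=\frac{\partial F}{\partial x^\mu}\frac{\partial G}{\partial p_\mu}-\frac{\partial F}{\partial p_\mu}\frac{\partial G}{\partial x^\mu}$. Binary interaction: $V(z,z')=V(z',z)$ is a scalar potential energy, vanishing when $z,z'$ are not causally related, and $\Phi(z)=\int f(z')V(z,z')\,dz'$ is its ensemble average. The pair Hamiltonian is $\mathcal H_{12}=\mathcal H+V+\mathcal H'$. Landau--Einstein system: the kinetic equation $\{f/\gamma,\mathcal H\}=\mathscr C(f,f)$ coupled to Einstein's equations for $g$. A thermodynamic equilibrium is, by definition, a distribution $f$ and metric $g$ with $\partial f/\partial t=0$, $\partial g/\partial t=0$, and such that the collision term and the term $\{f/\gamma,\mathcal H\}$ both vanish. Modified collision operator: $\mathbb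 P_{\Sigma'}$ is a projector of $T_z(T^*M)$ onto the $5$-dimensional subspace $\Sigma'_z=\{\delta z: d\chi(\delta z)=0,\ dx^0(\delta z)=0,\ dp_0(\delta z)=0\}$ (where $d\chi,dx^0,dp_0$ are linearly independent), and $J_{\Sigma'}=\mathbb P_{\Sigma'}\cdot J_c\cdot\mathbb P_{\Sigma'}$, i.e. $J_{\Sigma'}^{AB}=(\mathbb P_{\Sigma'})^A{}_C\,J_c^{CD}\,(\mathbb P_{\Sigma'})^B{}_D$; it is antisymmetric. With all quantities evaluated at points $z,z'$ of equal coordinate-time $t$, $$\mathscr C_{\Sigma'}(f,f)=\frac{\partial}{\partial z}\cdot\left\{\frac f\gamma J_{\Sigma'}\cdot\int\frac{f'}{\gamma'}\left[\tilde\Pi\cdot J_{\Sigma'}'\cdot\frac{\partial\log(f'/\gamma')}{\partial z'}-\Pi\cdot J_{\Sigma'}\cdot\frac{\partial\log(f/\gamma)}{\partial z}\right]dV'\right\},$$ where $\tilde\Pi=-A\otimes A'$, $\Pi=A\otimes A$, and the covector $A$ is defined as follows. Let $a(z,z')$ be the covector $a=\int_t^{t+\tau_c}V_z\,ds$, the time integral, over the collision time $\tau_c>0$ and along the orbits of the two colliding particles (generated by $\mathcal H_{12}$) starting at $(z,z')$, of the projected gradient $V_z$ of $V$ in its first argument; $a'(z,z')=a(z',z)$. Put $\xi=\gamma^{-1}J_{\Sigma'}\cdot\frac{\partial\mathcal H}{\partial z}$, $q^A=\xi^A-\xi'^A$, $q_A=\delta_{AB}q^B$, $|q|^2=q_Aq^A$,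 $\Delta=a+a'$, $(\mathbb P_q^\perp)_A{}^B=\delta_A{}^B-q_Aq^B/|q|^2$ (components in the coordinates $z$, tensors at $z$ and $z'$ being combined componentwise). Then $$A_B=\frac1\gamma\sqrt{\frac{\Gamma_t}{2}}\left[(\mathbb P_q^\perp)_B{}^C a_C-\frac{\Delta\cdot\xi'}{|q|^2}q_B\right],$$ with $A'$ obtained by exchanging $z\leftrightarrow z'$ (so $q\to-q$, $\Delta\to\Delta$), and $\Gamma_t(z,z')=\Gamma_t(z',z)\ge0$ the scattering frequency. Convention for $\delta(\chi)$: it enforces the speed of light constraint $\chi=0$ and is treated formally as a function $e^{C(\chi)}$ of $\chi$ alone; in particular derivatives of $\log\delta(\chi)$ are proportional to $d\chi$. *)

(* Defs.v *)
From HB Require Import structures.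
From mathcomp Require Import all_boot all_order all_algebra.
From mathcomp Require Import all_classical all_reals all_analysis.

Set Implicit Arguments.
Unset Strict Implicit.
Unset Printing Implicit Defensive.

Import Order.TTheory GRing.Theory Num.Theory.
Import numFieldNormedType.Exports.

Local Open Scope classical_set_scope.
Local Open Scope ring_scope.

(** The manifold M carries global coordinates x = (x^0, x^1, x^2, x^3) and is
    identified with an open subset [U] of R^4; T^*M is [U] x R^4.  Vectors are
    columns, covectors are rows.  A phase space point z = (x, p) is the column
    stacking x^0, ..., x^3 over p_0, ..., p_3. *)

Notation spacetime R := 'cV[R]_4.
Notation phase R := 'cV[R]_(4 + 4).

Definition ix (mu : 'I_4) : 'I_(4 + 4) := lshift 4 mu.
Definition ip (mu : 'I_4) : 'I_(4 + 4) := rshift 4 mu.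

Definition pos (R : realType) (z : phase R) : spacetime R := usubmx z.
Definition xcoord (R : realType) (mu : 'I_4) (z : phase R) : R := z (ix mu) 0.
Definition pcoord (R : realType) (mu : 'I_4) (z : phase R) : R := z (ip mu) 0.

Definition cotangent (R : realType) (U : set (spacetime R)) : set (phase R) :=
  [set z | U (pos z)].

Definition basis_vec (R : realType) (A : 'I_(4 + 4)) : phase R := delta_mx A 0.
Definition dcoord (R : realType) (A : 'I_(4 + 4)) : 'rV[R]_(4 + 4) :=
  delta_mx 0 A.

Definition partial (R : realType) (A : 'I_(4 + 4)) (F : phase R -> R)
    (z : phase R) : R :=
  'D_(basis_vec R A) F z.

Definition grad (R : realType) (F : phase R -> R) (z : phase R) :
    'rV[R]_(4 + 4) :=
  \row_A partial A F z.

Definition C1_on (R : realType) (D : set (phase R)) (F : phase R -> R) : Prop :=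
  forall z, D z ->
    differentiable F z /\ forall A, {for z, continuous (partial A F)}.

(** Since x^0 = c t, the derivation d/dt is the directional derivative along
    c e_0.  "Independent of t" includes that the derivative exists. *)
Definition stationary_on (R : realType) (W : normedModType R) (c : R)
    (D : set (phase R)) (F : phase R -> W) : Prop :=
  forall z, D z -> is_derive z (c *: basis_vec R (ix 0)) F 0.

Definition stationary_metric (R : realType) (c : R) (U : set (spacetime R))
    (g : spacetime R -> 'M[R]_4) : Prop :=
  forall x, U x -> is_derive x (c *: (delta_mx 0 0 : spacetime R)) g 0.

(** J_c: {F,G} = J_c^{AB} d_A F d_B G, so J_c^{x^mu p_mu} = 1. *)
Definition Jc (R : realType) : 'M[R]_(4 + 4) :=
  block_mx 0 1%:M (- 1%:M) 0.

Definition bracket (R : realType) (F G : phase R -> R) (z : phase R) : R :=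
  \sum_(mu < 4) (partial (ix mu) F z * partial (ip mu) G z
                 - partial (ip mu) F z * partial (ix mu) G z).

Definition minkowski (R : realType) : 'M[R]_4 :=
  diag_mx (\row_(mu < 4) (if mu == 0 then -1 else 1)).

Definition lorentzian_matrix (R : realType) (G : 'M[R]_4) : Prop :=
  G^T = G /\ exists2 E, E \in unitmx & E^T *m G *m E = minkowski R.

Definition lorentzian_metric (R : realType) (U : set (spacetime R))
    (g : spacetime R -> 'M[R]_4) : Prop :=
  forall x, U x -> differentiable g x /\ lorentzian_matrix (g x).

(** Existence of a regular C^1 curve with everywhere timelike or null tangent.
    The nonvanishing continuous tangent cannot leave its half of the light
    cone, so no time orientation is needed; the relation is symmetric and a
    point is related to itself. *)
Definition causally_related (R : realType) (U : set (spacetime R))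
    (g : spacetime R -> 'M[R]_4) (x y : spacetime R) : Prop :=
  x = y \/
  exists sigma : R -> spacetime R,
    [/\ sigma 0 = x, sigma 1 = y,
        {within `[0, 1], continuous ('D_1 sigma)} &
        forall s, s \in `[0, 1] ->
          [/\ U (sigma s), derivable sigma s 1, 'D_1 sigma s != 0 &
              (('D_1 sigma s)^T *m g (sigma s) *m 'D_1 sigma s) 0 0 <= 0]].

(** [invmx (g x)] has entries g^{mu nu}. *)
Definition hamiltonian (R : realType) (m c : R)
    (g : spacetime R -> 'M[R]_4) (Phi : phase R -> R) (z : phase R) : R :=
  2^-1 * m * c ^+ 2 *
    (1 + (\sum_(mu < 4) \sum_(nu < 4)
            invmx (g (pos z)) mu nu * pcoord mu z * pcoord nu z)
         / (m ^+ 2 * c ^+ 2))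
  + Phi z.

Definition gamma (R : realType) (c : R) (H : phase R -> R) (z : phase R) : R :=
  c^-1 * partial (ip 0) H z.

Definition chi (R : realType) (c : R) (g : spacetime R -> 'M[R]_4)
    (H : phase R -> R) (z : phase R) : R :=
  c ^+ 2 + \sum_(mu < 4) \sum_(nu < 4)
    g (pos z) mu nu * partial (ip mu) H z * partial (ip nu) H z.

(** Points of T^*M at which f / gamma and the projector onto Sigma' make
    sense. *)
Definition regular (R : realType) (c : R) (U : set (spacetime R))
    (g : spacetime R -> 'M[R]_4) (H : phase R -> R) : set (phase R) :=
  [set z | [/\ cotangent U z, gamma c H z != 0 &
     free [:: grad (chi c g H) z; dcoord R (ix 0); dcoord R (ip 0)]]].

Definition Sigma' (R : realType) (c : R) (g : spacetime R -> 'M[R]_4)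
    (H : phase R -> R) (z : phase R) : set ('cV[R]_(4 + 4)) :=
  [set dz | [/\ grad (chi c g H) z *m dz = 0, dcoord R (ix 0) *m dz = 0 &
                dcoord R (ip 0) *m dz = 0]].

Definition projector_onto (R : realType) (n : nat) (P : 'M[R]_n)
    (S : set 'cV[R]_n) : Prop :=
  P *m P = P /\ range (fun v : 'cV[R]_n => P *m v) = S.

Definition JSigma (R : realType) (P : phase R -> 'M[R]_(4 + 4)) (z : phase R) :
    'M[R]_(4 + 4) :=
  P z *m Jc R *m (P z)^T.

Definition H12 (R : realType) (H : phase R -> R) (V : phase R -> phase R -> R)
    (z z' : phase R) : R :=
  H z + V z z' + H z'.

(** Velocity of the first particle of the pair in the coordinate-time
    parametrization: dz/dt = (dt/dtau)^-1 J_c . dH12/dz, where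
    dt/dtau = c^-1 dH12/dp_0; its x^0 component is c.  As H12 is symmetric,
    exchanging the arguments gives the velocity of the second particle. *)
Definition pair_velocity (R : realType) (c : R) (H : phase R -> R)
    (V : phase R -> phase R -> R) (z z' : phase R) : phase R :=
  (gamma c (H12 H V ^~ z') z)^-1 *: (Jc R *m (grad (H12 H V ^~ z') z)^T).

(** [o] is the pair of orbits issued from (z, z') at their common coordinate
    time t = x^0 / c, followed during the collision time. *)
Definition is_pair_orbit (R : realType) (c tauc : R) (U : set (spacetime R))
    (H : phase R -> R) (V : phase R -> phase R -> R) (z z' : phase R)
    (o : R -> phase R * phase R) : Prop :=
  let t := xcoord 0 z / c in
  o t = (z, z') /\
  forall s, s \in `[t, t + tauc] ->
    [/\ cotangent U (o s).1, cotangent U (o s).2,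
        is_derive s 1 (fun r => (o r).1) (pair_velocity c H V (o s).1 (o s).2) &
        is_derive s 1 (fun r => (o r).2) (pair_velocity c H V (o s).2 (o s).1)].

Definition projected_gradV (R : realType) (V : phase R -> phase R -> R)
    (P : phase R -> 'M[R]_(4 + 4)) (z z' : phase R) : 'rV[R]_(4 + 4) :=
  grad (V ^~ z') z *m P z.

(** The covector a(z,z'); [orb z z'] is the pair of orbits issued from
    (z,z'). *)
Definition impulse (R : realType) (c tauc : R) (V : phase R -> phase R -> R)
    (P : phase R -> 'M[R]_(4 + 4))
    (orb : phase R -> phase R -> R -> phase R * phase R) (z z' : phase R) :
    'rV[R]_(4 + 4) :=
  let t := xcoord 0 z / c in
  \row_B (\int[lebesgue_measure]_(s in `[t, t + tauc])
            (projected_gradV V P (orb z z' s).1 (orb z z' s).2) 0 B).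

Definition xi (R : realType) (c : R) (H : phase R -> R)
    (P : phase R -> 'M[R]_(4 + 4)) (z : phase R) : 'cV[R]_(4 + 4) :=
  (gamma c H z)^-1 *: (JSigma P z *m (grad H z)^T).

Definition qrel (R : realType) (c : R) (H : phase R -> R)
    (P : phase R -> 'M[R]_(4 + 4)) (z z' : phase R) : 'cV[R]_(4 + 4) :=
  xi c H P z - xi c H P z'.

Definition sqnorm (R : realType) (n : nat) (q : 'cV[R]_n) : R :=
  \sum_A q A 0 ^+ 2.

Definition perp_proj (R : realType) (n : nat) (q : 'cV[R]_n) : 'M[R]_n :=
  1%:M - (sqnorm q)^-1 *: (q *m q^T).

(** The covector A(z,z'), for an arbitrary impulse [a] and frequency [Gam];
    A' is [Acov] with exchanged arguments. *)
Definition Acov (R : realType) (c : R) (H : phase R -> R)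
    (P : phase R -> 'M[R]_(4 + 4)) (a : phase R -> phase R -> 'rV[R]_(4 + 4))
    (Gam : phase R -> phase R -> R) (z z' : phase R) : 'rV[R]_(4 + 4) :=
  let q := qrel c H P z z' in
  let Delta := a z z' + a z' z in
  ((gamma c H z)^-1 * Num.sqrt (Gam z z' / 2)) *:
    (a z z' *m perp_proj q
     - ((Delta *m xi c H P z') 0 0 / sqnorm q) *: q^T).

Section Volume.
Variable R : realType.
Local Notation leb := (@lebesgue_measure R).

(** dV = dx^1 dx^2 dx^3 dp_0 dp_1 dp_2 dp_3. *)
Definition dV : {measure set _ -> \bar R} :=
  (leb \x leb \x leb \x leb \x leb \x leb \x leb)%E.

Definition dz : {measure set _ -> \bar R} :=
  (leb \x leb \x leb \x leb \x leb \x leb \x leb \x leb)%E.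

End Volume.
Arguments dV : clear implicits.
Arguments dz : clear implicits.

Definition col4 (R : realType) (a b c d : R) : 'cV[R]_4 :=
  \col_(i < 4) nth 0 [:: a; b; c; d] i.

Definition point (R : realType) (w : R * R * R * R * R * R * R * R) : phase R :=
  let: (x0, x1, x2, x3, p0, p1, p2, p3) := w in
  col_mx (col4 x0 x1 x2 x3) (col4 p0 p1 p2 p3).

(** The point with given x^0 and remaining seven coordinates. *)
Definition slice_point (R : realType) (x0 : R) (w : R * R * R * R * R * R * R) :
    phase R :=
  let: (x1, x2, x3, p0, p1, p2, p3) := w in
  col_mx (col4 x0 x1 x2 x3) (col4 p0 p1 p2 p3).

(** Phi(z) = int f(z') V(z,z') dz' for z in T^*M, the integral being
    convergent. *)
Definition ensemble_average (R : realType) (U : set (spacetime R))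
    (f : phase R -> R) (V : phase R -> phase R -> R) (Phi : phase R -> R) :
    Prop :=
  let D := [set w | cotangent U (point w)] in
  forall z, cotangent U z ->
    (dz R).-integrable D (fun w => (f (point w) * V z (point w))%:E) /\
    Phi z = \int[dz R]_(w in D) (f (point w) * V z (point w)).

Definition grad_log (R : realType) (c : R) (H f : phase R -> R) (z : phase R) :
    'rV[R]_(4 + 4) :=
  grad (fun y => ln (f y / gamma c H y)) z.

(** Pi~ . J' . dlog(f'/gamma')/dz' - Pi . J . dlog(f/gamma)/dz, a covector at
    z written as a column so that J(z) can act on it from the left. *)
Definition collision_kernel (R : realType) (c : R) (H : phase R -> R)
    (P : phase R -> 'M[R]_(4 + 4)) (a : phase R -> phase R -> 'rV[R]_(4 + 4))
    (Gam : phase R -> phase R -> R) (f : phase R -> R) (z z' : phase R) :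
    'cV[R]_(4 + 4) :=
  let A := Acov c H P a Gam z z' in
  let A' := Acov c H P a Gam z' z in
  let Pit := - (A^T *m A') in
  let Pi := A^T *m A in
  Pit *m JSigma P z' *m (grad_log c H f z')^T
  - Pi *m JSigma P z *m (grad_log c H f z)^T.

(** The integral runs over the points z' of T^*M at the coordinate time of z
    at which the integrand is defined: f'/gamma' and J' require z' to be
    regular, and A, A' divide by |q|^2.  When f' / gamma' vanishes the value
    of [ln] is irrelevant, since the kernel is multiplied by f' / gamma'. *)
Definition collision_flux (R : realType) (c : R) (U : set (spacetime R))
    (g : spacetime R -> 'M[R]_4) (H : phase R -> R)
    (P : phase R -> 'M[R]_(4 + 4)) (a : phase R -> phase R -> 'rV[R]_(4 + 4))
    (Gam : phase R -> phase R -> R) (f : phase R -> R) (z : phase R) :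
    'cV[R]_(4 + 4) :=
  let z' := slice_point (xcoord 0 z) in
  let D := [set w | regular c U g H (z' w) /\ qrel c H P z (z' w) != 0] in
  (f z / gamma c H z) *: (JSigma P z *m
    \col_B (\int[dV R]_(w in D)
              (f (z' w) / gamma c H (z' w)
               * collision_kernel c H P a Gam f z (z' w) B 0))).

Definition collision (R : realType) (c : R) (U : set (spacetime R))
    (g : spacetime R -> 'M[R]_4) (H : phase R -> R)
    (P : phase R -> 'M[R]_(4 + 4)) (a : phase R -> phase R -> 'rV[R]_(4 + 4))
    (Gam : phase R -> phase R -> R) (f : phase R -> R) (z : phase R) : R :=
  \sum_A partial A (fun y => collision_flux c U g H P a Gam f y A 0) z.

(** Each operator is required to vanish wherever it is defined: f / gamma
    needs gamma <> 0, the collision operator needs a regular point. *)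
Definition thermodynamic_equilibrium (R : realType) (c : R)
    (U : set (spacetime R)) (g : spacetime R -> 'M[R]_4) (H : phase R -> R)
    (coll : (phase R -> R) -> phase R -> R) (f : phase R -> R) : Prop :=
  [/\ forall z, cotangent U z -> gamma c H z != 0 ->
        bracket (fun y => f y / gamma c H y) H z = 0,
      forall z, regular c U g H z -> coll f z = 0,
      stationary_on c (cotangent U) f &
      stationary_metric c U g].

(** delta(chi) is represented by exp(C(chi)). *)
Definition f_infty (R : realType) (c beta Z : R) (C zeta : R -> R)
    (g : spacetime R -> 'M[R]_4) (H : phase R -> R) (z : phase R) : R :=
  Z^-1 * gamma c H z * expR (C (chi c g H z)) * expR (- beta * H z)
  * zeta (pcoord 0 z).

(* Main.v *)
(** The invariants behind the proof are chi, H and p_0: they Poisson-commute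
    with H (for p_0 this is the time symmetry), and f / gamma is a function of
    them, so {f / gamma, H} = 0.  Since J_Sigma' annihilates d chi and dp_0,
    J_Sigma' . dlog(f / gamma) = - beta gamma xi, and the collision integrand
    becomes beta A^T (gamma A . xi + gamma' A' . xi'), which vanishes because
    A is built so that a collision conserves the energy H + H' to leading
    order. *)

Require Import Defs.
From mathcomp Require Import all_boot all_order all_algebra ring.
From mathcomp Require Import all_classical all_reals all_analysis.

Set Implicit Arguments.
Unset Strict Implicit.
Unset Printing Implicit Defensive.

Import Order.TTheory GRing.Theory Num.Theory.
Import numFieldNormedType.Exports.

Local Open Scope classical_set_scope.
Local Open Scope ring_scope.

(** * Real functions along a line: constancy and the chain rule *)

Lemma segment_cst (R : realType) (phi : R -> R) (s : R) :
  (forall r : R, `|r| <= `|s| -> is_derive r 1 phi 0) -> phi s = phi 0.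
Proof.
move=> phi0; apply/eqP; rewrite -subr_eq0; apply/eqP.
have cont a b : (forall r, r \in `[a, b] -> `|r| <= `|s|) ->
    {within `[a, b], continuous phi}.
  move=> ab; apply: derivable_within_continuous => r /ab /phi0 dr.
  exact: ex_derive.
(* The mean value theorem needs ordered endpoints, so the two signs of [s] use [0, s] and [s, 0];
   the bound by [|s|] in the hypothesis covers both. *)
have [s0|/ltW s0] := leP 0 s.
  have in_s r : r \in `[0, s] -> `|r| <= `|s|.
    by rewrite in_itv/= => /andP[r0 rs]; rewrite !ger0_norm.
  have dphi r : r \in `]0, s[ -> is_derive r 1 phi (cst 0 r).
    by move=> /subset_itv_oo_cc /in_s /phi0.
  by have [r _ ->] := MVT_segment s0 dphi (cont _ _ in_s); rewrite mul0r.
have in_s r : r \in `[s, 0] -> `|r| <= `|s|.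
  by rewrite in_itv/= => /andP[rs r0]; rewrite !ler0_norm// lerN2.
have dphi r : r \in `]s, 0[ -> is_derive r 1 phi (cst 0 r).
  by move=> /subset_itv_oo_cc /in_s /phi0.
have [r _ E] := MVT_segment s0 dphi (cont _ _ in_s).
by rewrite -opprB E mul0r oppr0.
Qed.

(** Both sides have literally the same difference quotient. This transports one-variable results,
    such as the mean value theorem and the chain rule, to directional derivatives. *)
Lemma is_derive_lineP (R : realType) (V : normedModType R) (F : V -> R)
    (w v : V) (r df : R) :
  is_derive (w + r *: v) v F df <->
  is_derive r 1 (fun s => F (w + s *: v)) df.
Proof.
have E : (fun h : R => h^-1 *: (((fun s => F (w + s *: v)) \o shift r) (h *: 1)
      - F (w + r *: v))) =
    (fun h : R => h^-1 *: ((F \o shift (w + r *: v)) (h *: v)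
      - F (w + r *: v))).
  by apply/funext => h /=; rewrite [h *: 1](mulr1 h) scalerDl addrCA.
by split=> -[dF <-]; apply: DeriveDef; move: dF;
  rewrite /derivable /derive E.
Qed.

(** Restriction to the line through [z] reduces this to the one-variable chain rule, so derivability
    of [F] along [v] suffices; this is how the logarithm of f / gamma is differentiated. *)
Lemma is_derive_comp_real (R : realType) (V : normedModType R) (F : V -> R)
    (h : R -> R) (z v : V) (dF dh : R) :
  is_derive z v F dF -> is_derive (F z) 1 h dh ->
  is_derive z v (h \o F) (dh * dF).
Proof.
have z0 : z = z + 0 *: v by rewrite scale0r addr0.
rewrite {1 2 3}z0 => /is_derive_lineP dFz dhz; apply/is_derive_lineP.
exact: (is_derive1_comp (g := fun s => F (z + s *: v)) dhz dFz).
Qed.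

(** * Local invariance under translations along a fixed vector *)

Section Invariance.
Context (R : realType) (V : normedModType R).

(** The base point and the shift vary jointly in a neighbourhood. Unlike a derivative vanishing at
    one point, this passes to arbitrary functions of invariants and to derivatives in other
    directions, and it makes sense for values in any type. *)
Definition locally_invariant (T : Type) (v : V) (F : V -> T) (z : V) : Prop :=
  \forall p \near (z, (0 : R)), F (p.1 + p.2 *: v) = F p.1.

Lemma locally_invariant_derive0 (v : V) (D : set V) (F : V -> R) z :
  open D -> D z -> (forall w, D w -> is_derive w v F 0) ->
  locally_invariant v F z.
Proof.
move=> oD Dz dF.
have /nbhs_ballP[e /= e0 eD] : nbhs z D by exact: open_nbhs_nbhs.
have e20 : 0 < e / 2 by rewrite divr_gt0.
have v1 : 0 < `|v| + 1 by rewrite ltr_wpDl.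
have de : 0 < e / 2 / (`|v| + 1) by rewrite divr_gt0.
(* Half of the radius is spent on moving the base point and half on the shift; adding 1 to the norm
   of [v] avoids dividing by zero when [v] is 0. *)
exists (ball z (e / 2), ball (0 : R) (e / 2 / (`|v| + 1))).
  by split; apply: nbhsx_ballx.
move=> [w s] /= [zw]; rewrite -ball_normE /ball_/= sub0r normrN => s_small.
have -> : F w = F (w + 0 *: v) by rewrite scale0r addr0.
apply: (@segment_cst _ (fun r => F (w + r *: v))) => r rs.
apply: (proj1 (is_derive_lineP _ _ _ _ _)); apply: dF; apply: eD.
move: zw; rewrite -!ball_normE /ball_/= => zw.
rewrite opprD addrA (le_lt_trans (ler_normB _ _))// [ltRHS]splitr.
apply: ltr_leD => //; rewrite normrZ.
rewrite (le_trans (ler_wpM2r _ (le_trans rs (ltW s_small))))//.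
by rewrite -mulrA ler_piMr ?(ltW e20)// ler_pdivrMl// mulr1 lerDl.
Qed.

(** The derivative at a shifted point is the derivative of the translated function, which coincides
    with [F] near the original point. *)
Lemma locally_invariant_derive (u v : V) (F : V -> R) z :
  locally_invariant v F z -> locally_invariant v (fun y => 'D_u F y) z.
Proof.
(* Passing to the interior gives the invariance on a whole neighbourhood of each nearby pair, which
   is what a derivative at that pair can see. *)
rewrite /locally_invariant => Fz; have := nbhs_interior Fz.
apply: filterS => -[w s] /= Fws.
have -> : 'D_u F (w + s *: v) = 'D_u (fun y => F (y + s *: v)) w.
  rewrite /derive; set q := (X in lim (X @ _)).
  set q' := (X in _ = lim (X @ _)).
  suff -> : q = q' by [].
  by apply/funext => h; rewrite /q /q' /= addrA.
apply: near_eq_derive.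
case: Fws => -[A B] /= [wA sB] AB; apply: filterS wA => y Ay.
by apply: (AB (y, s)); split=> //; exact: nbhs_singleton.
Qed.

Lemma invariant_locally (T : Type) (v : V) (F : V -> T) z :
  (forall w s, F (w + s *: v) = F w) -> locally_invariant v F z.
Proof.
move=> Fv; exists (setT, setT) => /= [|p _]; last exact: Fv.
by split; exact: filterT.
Qed.

Lemma locally_invariant_pair (T T' : Type) (v : V) (F : V -> T) (G : V -> T')
    z :
  locally_invariant v F z -> locally_invariant v G z ->
  locally_invariant v (fun y => (F y, G y)) z.
Proof. by apply: filterS2 => p /= -> ->. Qed.

Lemma locally_invariant_ffun (I : finType) (T : Type) (v : V)
    (F : I -> V -> T) z :
  (forall i, locally_invariant v (F i) z) ->
  locally_invariant v (fun y => [ffun i => F i y]) z.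
Proof.
move=> Fz; have Fnear : \forall p \near (z, (0 : R)),
    forall i, F i (p.1 + p.2 *: v) = F i p.1.
  exact: (filter_forall _ Fz).
by apply: filterS Fnear => p Fp; apply/ffunP => i; rewrite !ffunE.
Qed.

Lemma locally_invariant_factor (T T' : Type) (v : V) (F : V -> T)
    (G : V -> T') z :
  (forall y y', F y = F y' -> G y = G y') ->
  locally_invariant v F z -> locally_invariant v G z.
Proof. by move=> FG; apply: filterS => p /FG. Qed.

(** The difference quotient is zero for all small nonzero shifts, so existence of the derivative
    comes together with its value. *)
Lemma is_derive_locally_invariant (v : V) (W : normedModType R) (F : V -> W) z :
  locally_invariant v F z -> is_derive z v F 0.
Proof.
move=> Fz.
have Fz0 : \forall h \near (0 : R), F (z + h *: v) = F z.
  case: Fz => -[A B] /= [zA sB] AB; apply: filterS sB => h Bh.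
  by apply: (AB (z, h)); split=> //; exact: nbhs_singleton.
have Fcvg : (fun h : R => h^-1 *: ((F \o shift z) (h *: v) - F z)) @ 0^'
    --> (0 : W).
  apply: cvg_near_cst; apply: nbhs_dnbhs; apply: filterS Fz0 => h Fh.
  by rewrite /= [h *: v + z]addrC Fh subrr scaler0.
by split; [exact: cvgP Fcvg|exact: cvg_lim Fcvg].
Qed.

End Invariance.

(** * Phase space coordinates, the bracket and independence of covectors *)

Section PhaseSpace.
Context (R : realType).
Implicit Types (U : set (spacetime R)) (z : phase R) (F G : phase R -> R).

Lemma continuous_pos : continuous (@pos R).
Proof.
move=> z A /nbhs_ballP[e /= e0 eA]; apply/nbhs_ballP; exists e => //= y zy.
case: zy => _ zy; apply: eA; split=> // i j.
by rewrite !mxE; exact: zy.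
Qed.

Lemma open_cotangent U : open U -> open (cotangent U).
Proof. by move=> oU; apply: open_comp => // z _; exact: continuous_pos. Qed.

Lemma derive_pcoord z (v : phase R) mu : 'D_v (pcoord mu) z = pcoord mu v.
Proof.
apply: cvg_lim => //; apply: cvg_near_cst.
apply: filterS (@nbhs_dnbhs_neq R 0) => h h0.
by rewrite /pcoord /= !mxE addrK [LHS]mulrA mulVf// mul1r.
Qed.

Lemma differentiable_pcoord z mu : differentiable (pcoord mu) z.
Proof. exact: differentiable_coord. Qed.

Lemma partial_pcoord z A mu : partial A (pcoord mu) z = dcoord R (ip mu) 0 A.
Proof.
by rewrite /partial derive_pcoord /pcoord /basis_vec !mxE andbT eq_sym.
Qed.

Lemma near_eq_partial F G z A :
  (\near z, F z = G z) -> partial A F z = partial A G z.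
Proof. exact: near_eq_derive. Qed.

(** The bracket sees only first partials at the point. This form fits the chain rule for a function
    of the three invariants. *)
Lemma bracket_linear3 (a b k : R) F F1 F2 F3 G z :
  (forall A, partial A F z =
     a * partial A F1 z + b * partial A F2 z + k * partial A F3 z) ->
  bracket F G z = a * bracket F1 G z + b * bracket F2 G z + k * bracket F3 G z.
Proof.
move=> dF; rewrite /bracket !mulr_sumr -!big_split/=; apply: eq_bigr => mu _.
rewrite !dF; do !move: (partial _ _ _) => ?.
by ring.
Qed.

Lemma bracketxx F z : bracket F F z = 0.
Proof. by rewrite /bracket big1// => mu _; rewrite mulrC subrr. Qed.

Lemma bracket_pcoord mu F z :
  bracket (pcoord mu) F z = - partial (ix mu) F z.
Proof.
rewrite /bracket (bigD1 mu)//= !partial_pcoord big1 ?addr0 => [|nu numu].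
  by rewrite !mxE !eqxx /= eq_lrshift mul0r mul1r sub0r.
rewrite !partial_pcoord !mxE /= eq_lrshift (inj_eq (@rshift_inj _ _)).
by rewrite (negPf numu) !mul0r subrr.
Qed.

(** Independence becomes the nonvanishing of one entry of [u], which is an open condition when [u]
    varies continuously. *)
Lemma free_dcoord (u : 'rV[R]_(4 + 4)) (i j : 'I_(4 + 4)) : i != j ->
  free [:: u; dcoord R i; dcoord R j] =
  [exists A, [&& A != i, A != j & u 0 A != 0]].
Proof.
move=> ij; rewrite free_cons.
have -> : free [:: dcoord R i; dcoord R j].
  rewrite free_cons seq1_free span_seq1; apply/andP; split.
    apply/negP => /vlineP[k] /rowP /(_ i); rewrite !mxE !eqxx/= (negPf ij).
    by rewrite mulr0 => /eqP; rewrite oner_eq0.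
  by apply/eqP => /rowP /(_ j); rewrite !mxE !eqxx => /eqP; rewrite oner_eq0.
rewrite andbT span_cons span_seq1; apply/idP/existsP => [|[A /and3P[Ai Aj uA]]].
  move=> uij; apply/existsP; apply: contraNT uij => /existsPn u0.
  have -> : u = u 0 i *: dcoord R i + u 0 j *: dcoord R j.
    apply/rowP => A; rewrite !mxE /=.
    have := u0 A; have [->|Ai] := eqVneq A i.
      by rewrite (negPf ij) mulr1 mulr0 addr0.
    have [->|Aj] := eqVneq A j; first by rewrite mulr1 mulr0 add0r.
    by rewrite /= negbK => /eqP ->; rewrite !mulr0 addr0.
  by apply: memv_add; apply/vlineP; [exists (u 0 i)|exists (u 0 j)].
apply: contraNN uA => /memv_addP[_ /vlineP[k ->]] [_ /vlineP[l ->]] ->.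
by rewrite !mxE (negPf Ai) (negPf Aj) !mulr0 addr0.
Qed.

End PhaseSpace.

(** * Energy balance of a collision as an identity of linear algebra *)

Lemma row_mul_col11 (R : realType) n (a : 'rV[R]_n) (x : 'cV[R]_n)
    (b : 'rV[R]_n) (y : 'cV[R]_n) :
  (a *m (x *m b) *m y) 0 0 = (a *m x) 0 0 * (b *m y) 0 0.
Proof. by rewrite mulmxA -mulmxA mxE big_ord1. Qed.

Lemma sqnormE (R : realType) n (q : 'cV[R]_n) : sqnorm q = (q^T *m q) 0 0.
Proof. by rewrite mxE; apply: eq_bigr => i _; rewrite mxE expr2. Qed.

(** The perpendicular projector kills q, hence acts alike on x and x', and the projected terms add
    up to D.x' - (D.q)(q.x')/|q|^2. The two corrections contribute ((D.x)(q.x') -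
    (D.x')(q.x))/|q|^2. The total is D.x' (|q|^2 + q.x' - q.x)/|q|^2, which is zero since |q|^2 =
    q.x - q.x'. *)
Lemma collision_energy_balance (R : realType) n (a a' : 'rV[R]_n)
    (x x' : 'cV[R]_n) :
  let q := x - x' in
  let D := a + a' in
  sqnorm q != 0 ->
  ((a *m perp_proj q - ((D *m x') 0 0 / sqnorm q) *: q^T) *m x) 0 0
  + ((a' *m perp_proj (- q) - ((D *m x) 0 0 / sqnorm (- q)) *: (- q)^T)
      *m x') 0 0 = 0.
Proof.
move=> q D q0.
(* The rank-one part of the projector splits into a product of two pairings, so that everything
   becomes a rational expression in scalars. *)
have perpE (b : 'rV[R]_n) (y : 'cV[R]_n) : (b *m perp_proj q *m y) 0 0 =
    (b *m y) 0 0 - (sqnorm q)^-1 * ((b *m q) 0 0 * (q^T *m y) 0 0).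
  rewrite /perp_proj mulmxBr mulmx1 mulmxBl -scalemxAr -scalemxAl.
  by rewrite -row_mul_col11 !mxE.
have -> : perp_proj (- q) = perp_proj q.
  rewrite /perp_proj /sqnorm linearN mulNmx mulmxN opprK.
  by under eq_bigr do rewrite mxE sqrrN.
have qN : sqnorm (- q) = sqnorm q.
  by rewrite /sqnorm; apply: eq_bigr => i _; rewrite mxE sqrrN.
rewrite qN linearN scalerN opprK mulmxBl mulmxDl -!scalemxAl.
have subE (u v : 'M[R]_1) : (u - v) 0 0 = u 0 0 - v 0 0 by rewrite !mxE.
have addE (u v : 'M[R]_1) : (u + v) 0 0 = u 0 0 + v 0 0 by rewrite !mxE.
have sclE k (u : 'M[R]_1) : (k *: u) 0 0 = k * u 0 0 by rewrite !mxE.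
have sE : sqnorm q = (q^T *m x) 0 0 - (q^T *m x') 0 0.
  by rewrite sqnormE -subE -mulmxBr.
have qE (b : 'rV[R]_n) : (b *m q) 0 0 = (b *m x) 0 0 - (b *m x') 0 0.
  by rewrite -subE -mulmxBr.
rewrite subE addE !sclE !perpE !qE /D !mulmxDl !addE.
move: q0; rewrite sE => q0; field.
exact: q0.
Qed.


(** * Time invariance of everything built from the metric and the potential *)

Section Stationarity.
Context (R : realType) (m c : R) (U : set (spacetime R))
  (g : spacetime R -> 'M[R]_4) (Phi : phase R -> R).
Hypotheses (oU : open U) (g_stationary : stationary_metric c U g)
  (Phi_stationary : stationary_on c (cotangent U) Phi).

Let H := hamiltonian m c g Phi.
Let dt : phase R := c *: basis_vec R (ix 0).

Lemma pos_time_shift : pos dt = c *: delta_mx 0 0.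
Proof.
by apply/matrixP => i j; rewrite !mxE (inj_eq (@lshift_inj _ _)).
Qed.

Lemma pcoord_time_shift mu (w : phase R) (s : R) :
  pcoord mu (w + s *: dt) = pcoord mu w.
Proof. by rewrite /pcoord !mxE eq_rlshift/= !mulr0 addr0. Qed.

Lemma is_derive_pos (F : spacetime R -> R) (z v : phase R) df :
  is_derive (pos z) (pos v) F df -> is_derive z v (F \o @pos R) df.
Proof.
move=> [dF <-].
have E : (fun h : R => h^-1 *: (((F \o @pos R) \o shift z) (h *: v)
      - (F \o @pos R) z)) =
    (fun h : R => h^-1 *: ((F \o shift (pos z)) (h *: pos v) - F (pos z))).
  by apply/funext => h; rewrite /= [pos _]linearP.
by apply: DeriveDef; rewrite /derivable /derive E.
Qed.

(** The passage from zero derivative to invariance is for real-valued functions, so it is applied to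
    each entry and the entries are reassembled. *)
Lemma locally_invariant_metric z :
  cotangent U z -> locally_invariant dt (g \o @pos R) z.
Proof.
move=> Uz.
have gij i j : locally_invariant dt (fun w => g (pos w) i j) z.
  apply: (locally_invariant_derive0 (open_cotangent oU) Uz) => w Uw.
  apply: (@is_derive_pos (fun x => g x i j)); rewrite pos_time_shift.
  have [dg] := g_stationary Uw; rewrite derive_mx// => g0.
  split; first exact: (derivable_mxP _ _ _).1 dg i j.
  by have /matrixP/(_ i j) := g0; rewrite !mxE.
have := locally_invariant_ffun
  (fun ij : 'I_4 * 'I_4 => gij ij.1 ij.2).
apply: locally_invariant_factor => y y' /ffunP gyy'.
by apply/matrixP => i j; have := gyy' (i, j); rewrite !ffunE.
Qed.

Lemma locally_invariant_pcoord z :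
  locally_invariant dt (fun y => [ffun mu => pcoord mu y]) z.
Proof.
apply: locally_invariant_ffun => mu; apply: invariant_locally => w s.
exact: pcoord_time_shift.
Qed.

(** [H] is a function of the momenta, the metric and [Phi], all invariant; the inverse metric is
    covered without being differentiated. *)
Lemma locally_invariant_hamiltonian z :
  cotangent U z -> locally_invariant dt H z.
Proof.
move=> Uz; have gz := locally_invariant_metric Uz.
have Phiz := locally_invariant_derive0 (open_cotangent oU) Uz Phi_stationary.
have := locally_invariant_pair (locally_invariant_pcoord z)
  (locally_invariant_pair gz Phiz).
apply: locally_invariant_factor => y y' [/ffunP pE gE PhiE].
rewrite /H /hamiltonian gE PhiE; congr (_ * (1 + _ / _) + _).
apply: eq_bigr => mu _; apply: eq_bigr => nu _.
by have := pE mu; have := pE nu; rewrite !ffunE => -> ->.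
Qed.

Lemma locally_invariant_gamma z :
  cotangent U z -> locally_invariant dt (gamma c H) z.
Proof.
move=> /locally_invariant_hamiltonian.
move=> /(locally_invariant_derive (basis_vec R (ip 0))).
by apply: locally_invariant_factor => y y' HE; congr (_ * _).
Qed.

Lemma locally_invariant_chi z :
  cotangent U z -> locally_invariant dt (chi c g H) z.
Proof.
move=> Uz; have gz := locally_invariant_metric Uz.
have Hmu mu : locally_invariant dt (partial (ip mu) H) z.
  by apply: locally_invariant_derive; exact: locally_invariant_hamiltonian.
have := locally_invariant_pair gz (locally_invariant_ffun Hmu).
apply: locally_invariant_factor => y y' [gE /ffunP HE].
rewrite /chi; congr (_ + _).
apply: eq_bigr => mu _; apply: eq_bigr => nu _.
by have := HE mu; have := HE nu; rewrite !ffunE gE => -> ->.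
Qed.

Lemma f_infty_stationary (beta Z : R) (C zeta : R -> R) :
  stationary_on c (cotangent U) (f_infty c beta Z C zeta g H).
Proof.
move=> z Uz; apply: is_derive_locally_invariant.
have := locally_invariant_pair (locally_invariant_pcoord z)
  (locally_invariant_pair (locally_invariant_gamma Uz)
  (locally_invariant_pair (locally_invariant_chi Uz)
  (locally_invariant_hamiltonian Uz))).
apply: locally_invariant_factor => y y' [/ffunP /(_ 0) pE gammaE chiE HE].
by move: pE; rewrite /f_infty gammaE chiE HE !ffunE => ->.
Qed.

Lemma partial_time_hamiltonian z : c != 0 ->
  cotangent U z -> differentiable H z -> partial (ix 0) H z = 0.
Proof.
move=> c0 Uz dH.
have [_] := is_derive_locally_invariant (locally_invariant_hamiltonian Uz).
(* The invariance is along [c] times the basis vector; linearity of the differential extracts the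
   factor [c], which is then cancelled. *)
rewrite /partial !deriveE// linearZ => /eqP.
by rewrite scaler_eq0 (negPf c0) => /eqP.
Qed.

End Stationarity.

(** * Vanishing of the bracket and of the collision operator *)

Lemma scale_invl_mulmx (R : fieldType) n (k s : R) (b : 'rV[R]_n)
    (x : 'cV[R]_n) :
  k != 0 -> k *: ((k^-1 * s) *: b *m x) = s *: (b *m x).
Proof. by move=> k0; rewrite -scalemxAl scalerA mulVKf. Qed.

Lemma near_neq0 (R : realType) (F : phase R -> R) z :
  {for z, continuous F} -> F z != 0 -> \forall y \near z, F y != 0.
Proof.
move=> Fc F0; have : F @ z --> F z by [].
by move=> /cvgr_neq0 /(_ F0).
Qed.

Lemma diff_is_derive (R : realType) (F : phase R -> R) (z v : phase R) :
  differentiable F z -> is_derive z v F ('D_v F z).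
Proof. by move=> dF; split=> //; exact: diff_derivable. Qed.

Section Equilibrium.
Context (R : realType) (c beta Z : R) (C zeta : R -> R) (U : set (spacetime R))
  (g : spacetime R -> 'M[R]_4) (H : phase R -> R).
Hypotheses (Z_gt0 : 0 < Z) (oU : open U)
  (H_C1 : C1_on (cotangent U) H) (chi_C1 : C1_on (cotangent U) (chi c g H))
  (dC : forall y, derivable C y 1) (dzeta : forall y, derivable zeta y 1)
  (zeta_ge0 : forall y, 0 <= zeta y).

Let f := f_infty c beta Z C zeta g H.
(** This is f / gamma after cancellation, a function of chi, H and p_0 only, so that gamma itself
    never has to be differentiated. *)
Let rho (z : phase R) : R :=
  Z^-1 * expR (C (chi c g H z)) * expR (- beta * H z) * zeta (pcoord 0 z).

Lemma near_cotangent z : cotangent U z -> \forall y \near z, cotangent U y.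
Proof. by move=> Uz; exact: open_nbhs_nbhs (conj (open_cotangent oU) Uz). Qed.

Lemma near_gamma_neq0 z : cotangent U z -> gamma c H z != 0 ->
  \forall y \near z, gamma c H y != 0.
Proof.
move=> Uz; rewrite mulf_eq0 negb_or => /andP[ci pz].
have [_ /(_ (ip 0)) cont] := H_C1 Uz.
by apply: filterS (near_neq0 cont pz) => y py; rewrite mulf_neq0.
Qed.

(** The collision operator is a divergence, so its flux has to be controlled on a neighbourhood of a
    regular point. *)
Lemma near_regular z : regular c U g H z ->
  \forall y \near z, regular c U g H y.
Proof.
have ij : ix 0 != ip 0 by rewrite eq_lrshift.
move=> [Uz gz]; rewrite free_dcoord// => /existsP[A /and3P[A1 A2]].
rewrite mxE => chiz; have [_ /(_ A) cont] := chi_C1 Uz.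
have UU := near_cotangent Uz; have gg := near_gamma_neq0 Uz gz.
apply: filterS3 UU gg (near_neq0 cont chiz) => y Uy gy chiy.
split=> //; rewrite free_dcoord//; apply/existsP; exists A.
by rewrite A1 A2 mxE.
Qed.

Lemma f_over_gamma z : gamma c H z != 0 -> f z / gamma c H z = rho z.
Proof.
by move=> gz; rewrite /f /f_infty /rho; field; rewrite gz gt_eqF.
Qed.

(** [zeta] may have zeros, and these are exactly the points where log(f / gamma) loses its meaning;
    the collision integral is split accordingly. *)
Lemma rho_gt0 z : (0 < rho z) = (zeta (pcoord 0 z) != 0).
Proof.
rewrite /rho pmulr_rgt0; first by rewrite lt0r zeta_ge0 andbT.
by rewrite !mulr_gt0 ?expR_gt0 ?invr_gt0.
Qed.

Lemma near_f_over_gamma z : cotangent U z -> gamma c H z != 0 ->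
  \forall y \near z, f y / gamma c H y = rho y.
Proof.
by move=> Uz gz; apply: filterS (near_gamma_neq0 Uz gz) => y /f_over_gamma.
Qed.

(** The coefficient of dp_0 in the differential of [rho], written with the derivative of [zeta]
    rather than its logarithmic derivative so that it stays valid at zeros of [zeta]. *)
Let kappa (z : phase R) : R :=
  Z^-1 * expR (C (chi c g H z)) * expR (- beta * H z)
  * derive1 zeta (pcoord 0 z).

Lemma is_derive_rho z (v : phase R) : cotangent U z ->
  is_derive z v rho (rho z * derive1 C (chi c g H z) * 'D_v (chi c g H) z
    + (- beta * rho z) * 'D_v H z + kappa z * 'D_v (pcoord 0) z).
Proof.
move=> Uz; have [dH _] := H_C1 Uz; have [dchi _] := chi_C1 Uz.
have dC1 (y : R) : is_derive y 1 C (derive1 C y) by split; rewrite ?derive1E.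
have dz1 (y : R) : is_derive y 1 zeta (derive1 zeta y).
  by split; rewrite ?derive1E.
pose eC y := expR (C (chi c g H y)); pose eH y := expR (- beta * H y).
have deC : is_derive z v eC
    (eC z * derive1 C (chi c g H z) * 'D_v (chi c g H) z).
  exact: is_derive_comp_real (diff_is_derive v dchi)
    (is_derive1_comp (is_derive_expR _) (dC1 _)).
have deH : is_derive z v eH (eH z * (- beta * 1) * 'D_v H z).
  exact: is_derive_comp_real (diff_is_derive v dH)
    (is_derive1_comp (is_derive_expR _)
      (is_deriveZ (- beta) (is_derive_id (H z) (1 : R)))).
have dzetap := is_derive_comp_real
  (diff_is_derive v (differentiable_pcoord z 0)) (dz1 _).
have deCH : is_derive z v (fun y => Z^-1 * eC y * eH y)
    (Z^-1 * eC z * (eH z * (- beta * 1) * 'D_v H z)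
     + eH z * (Z^-1 * (eC z * derive1 C (chi c g H z) * 'D_v (chi c g H) z))).
  exact: (is_deriveM (is_deriveZ Z^-1 deC) deH).
apply: (@is_derive_eq _ _ _ _ _ _ _ _ (is_deriveM deCH dzetap)).
rewrite /rho /kappa -/(eC z) -/(eH z) /GRing.scale /=.
by ring.
Qed.

Lemma partial_rho z A : cotangent U z ->
  partial A rho z = rho z * derive1 C (chi c g H z) * partial A (chi c g H) z
    + (- beta * rho z) * partial A H z + kappa z * partial A (pcoord 0) z.
Proof. by move=> Uz; have [] := @is_derive_rho z (basis_vec R A) Uz. Qed.

Lemma bracket_f_over_gamma z : cotangent U z -> gamma c H z != 0 ->
  bracket (chi c g H) H z = 0 -> partial (ix 0) H z = 0 ->
  bracket (fun y => f y / gamma c H y) H z = 0.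
Proof.
move=> Uz gz chiH H0.
rewrite (bracket_linear3 (a := rho z * derive1 C (chi c g H z))
  (b := - beta * rho z) (k := kappa z) (F1 := chi c g H) (F2 := H)
  (F3 := pcoord 0)).
  by rewrite chiH bracketxx bracket_pcoord H0 oppr0 !mulr0 !addr0.
move=> A; rewrite -partial_rho//.
exact: near_eq_partial (near_f_over_gamma Uz gz).
Qed.

Lemma grad_log_f z : cotangent U z -> gamma c H z != 0 -> 0 < rho z ->
  grad_log c H f z = derive1 C (chi c g H z) *: grad (chi c g H) z
    - beta *: grad H z + (kappa z / rho z) *: dcoord R (ip 0).
Proof.
move=> Uz gz rz; apply/rowP => A; rewrite !mxE.
rewrite (@near_eq_partial _ _ (@ln R \o rho)); last first.
  by apply: filterS (near_f_over_gamma Uz gz) => y /= ->.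
have [_ E] := is_derive_comp_real (@is_derive_rho z (basis_vec R A) Uz)
  (is_derive1_ln rz).
rewrite [LHS]E -!/(partial A _ z) partial_pcoord mxE.
by field; rewrite gt_eqF.
Qed.

Context (P : phase R -> 'M[R]_(4 + 4)).
Hypothesis P_projector :
  forall z, regular c U g H z -> projector_onto (P z) (Sigma' c g H z).

(** The columns of [P z] lie in Sigma', so a covector [u] vanishing there satisfies u P = 0, and the
    right-hand factor of P Jc P^T u^T is the transpose of u P. *)
Lemma JSigma_annihilator (z : phase R) (u : 'rV[R]_(4 + 4)) :
  regular c U g H z -> (forall v, Sigma' c g H z v -> u *m v = 0) ->
  JSigma P z *m u^T = 0.
Proof.
move=> /P_projector[_ PS] uS; rewrite /JSigma -!mulmxA -trmx_mul.
have -> : u *m P z = 0; last by rewrite trmx0 !mulmx0.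
apply/rowP => j; rewrite mxE.
have /uS : Sigma' c g H z (P z *m delta_mx j 0).
  by rewrite -PS; exists (delta_mx j 0).
by rewrite mulmxA => /matrixP /(_ 0 0); rewrite -colE !mxE.
Qed.

Lemma JSigma_grad_log_f z : regular c U g H z -> 0 < rho z ->
  JSigma P z *m (grad_log c H f z)^T = (- beta * gamma c H z) *: xi c H P z.
Proof.
move=> rz rhoz; have [Uz gz _] := rz.
have -> : (grad_log c H f z)^T =
    derive1 C (chi c g H z) *: (grad (chi c g H) z)^T - beta *: (grad H z)^T
    + (kappa z / rho z) *: (dcoord R (ip 0))^T.
  by rewrite grad_log_f//; apply/matrixP => i j; rewrite !mxE.
rewrite mulmxDr mulmxBr -!scalemxAr.
rewrite (JSigma_annihilator rz (u := grad (chi c g H) z)); last by move=> v [].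
rewrite (JSigma_annihilator rz (u := dcoord R (ip 0))); last by move=> v [].
by rewrite !scaler0 addr0 sub0r scalerA mulfK// scaleNr.
Qed.

(** Each gamma cancels the prefactor 1/gamma of its covector, the symmetry of [Gam] leaves a common
    square root, and exchanging the points flips q and keeps Delta; what remains is
    [collision_energy_balance]. *)
Lemma gamma_Acov_xi (a : phase R -> phase R -> 'rV[R]_(4 + 4))
    (Gam : phase R -> phase R -> R) (z z' : phase R) :
  Gam z z' = Gam z' z ->
  gamma c H z != 0 -> gamma c H z' != 0 -> qrel c H P z z' != 0 ->
  gamma c H z *: (Acov c H P a Gam z z' *m xi c H P z)
  + gamma c H z' *: (Acov c H P a Gam z' z *m xi c H P z') = 0.
Proof.
move=> Gsym gz gz' q0.
have s0 : sqnorm (qrel c H P z z') != 0.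
  apply: contraNneq q0 => /psumr_eq0P s0; apply/eqP/colP => i.
  rewrite [RHS]mxE; apply/eqP; rewrite -sqrf_eq0 s0// => j _.
  exact: sqr_ge0.
have AE y y' : gamma c H y != 0 ->
    gamma c H y *: (Acov c H P a Gam y y' *m xi c H P y) =
    Num.sqrt (Gam y y' / 2) *: ((a y y' *m perp_proj (qrel c H P y y')
      - (((a y y' + a y' y) *m xi c H P y') 0 0 / sqnorm (qrel c H P y y'))
        *: (qrel c H P y y')^T) *m xi c H P y).
  exact: scale_invl_mulmx.
rewrite (AE z z' gz) (AE z' z gz') Gsym -scalerDr (addrC (a z' z)).
have -> : qrel c H P z' z = - qrel c H P z z' by rewrite /qrel opprB.
set w := _ + _; suff -> : w = 0 by rewrite scaler0.
rewrite /w; apply/matrixP => i j; rewrite !ord1 [LHS]mxE [RHS]mxE.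
exact: collision_energy_balance.
Qed.

Lemma collision_kernel_eq0 (a : phase R -> phase R -> 'rV[R]_(4 + 4))
    (Gam : phase R -> phase R -> R) (z z' : phase R) :
  Gam z z' = Gam z' z -> regular c U g H z -> regular c U g H z' ->
  0 < rho z -> 0 < rho z' -> qrel c H P z z' != 0 ->
  collision_kernel c H P a Gam f z z' = 0.
Proof.
move=> Gsym rz rz' rhoz rhoz' q0; have [_ gz _] := rz; have [_ gz' _] := rz'.
rewrite /collision_kernel.
rewrite -(mulmxA _ (JSigma P z')) -(mulmxA _ (JSigma P z)).
rewrite !JSigma_grad_log_f//.
have := gamma_Acov_xi a Gsym gz gz' q0.
move: (xi c H P z) (xi c H P z') (Acov _ _ _ _ _ _ _) (Acov _ _ _ _ _ _ _).
move: (gamma c H z) (gamma c H z').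
(* Only the relation [AE] between the two pairings is used from here, so the gammas, velocities and
   covectors are abstracted. *)
move=> k k' x x' A' A /eqP; rewrite addr_eq0 => /eqP AE.
rewrite mulNmx -!mulmxA -!scalemxAr -!scalerA.
rewrite [k *: _]scalemxAr [k' *: _]scalemxAr AE.
by rewrite mulmxN scalerN opprK addNr.
Qed.

Lemma collision_flux_eq0 (a : phase R -> phase R -> 'rV[R]_(4 + 4))
    (Gam : phase R -> phase R -> R) (z : phase R) :
  (forall y y', Gam y y' = Gam y' y) -> regular c U g H z ->
  collision_flux c U g H P a Gam f z = 0.
Proof.
move=> Gsym rz; have [_ gz _] := rz; rewrite /collision_flux f_over_gamma//.
(* At a zero of [zeta] the prefactor f / gamma vanishes and the logarithmic gradient is irrelevant;
   the same split is made for the second point under the integral. *)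
have [rhoz|] := boolP (0 < rho z); last first.
  by rewrite rho_gt0 negbK /rho => /eqP ->; rewrite mulr0 scale0r.
set w := \col_B _; suff -> : w = 0 by rewrite mulmx0 scaler0.
apply/colP => B; rewrite !mxE.
rewrite (@eq_Rintegral _ _ _ _ _ (cst 0)); last first.
  move=> y; rewrite inE => -[ry qy]; have [_ gy _] := ry.
  rewrite f_over_gamma//=.
  have [rhoy|] := boolP (0 < rho (slice_point (xcoord 0 z) y)).
    by rewrite collision_kernel_eq0// mxE mulr0.
  by rewrite rho_gt0 negbK /rho => /eqP ->; rewrite mulr0 mul0r.
by rewrite /Rintegral integral0_eq.
Qed.

Lemma collision_f_eq0 (a : phase R -> phase R -> 'rV[R]_(4 + 4))
    (Gam : phase R -> phase R -> R) (z : phase R) :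
  (forall y y', Gam y y' = Gam y' y) -> regular c U g H z ->
  collision c U g H P a Gam f z = 0.
Proof.
move=> Gsym rz; apply: big1 => A _.
(* Each flux component is zero throughout a neighbourhood of [z], hence has zero partial derivatives
   there. *)
rewrite (@near_eq_partial _ _ (cst 0)); first exact: derive_cst.
apply: filterS (near_regular rz) => y ry.
by rewrite collision_flux_eq0// mxE.
Qed.

End Equilibrium.

Theorem mainTheorem1 (R : realType) (m c tauc beta Z : R) (C zeta : R -> R)
    (U : set (spacetime R)) (g : spacetime R -> 'M[R]_4)
    (Phi : phase R -> R) (V Gam : phase R -> phase R -> R)
    (P : phase R -> 'M[R]_(4 + 4))
    (orb : phase R -> phase R -> R -> phase R * phase R) :
  let H := hamiltonian m c g Phi in
  let f := f_infty c beta Z C zeta g H in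
  let a := impulse c tauc V P orb in
  0 < m -> 0 < c -> 0 < tauc -> 0 < Z ->
  open U -> lorentzian_metric U g ->
  C1_on (cotangent U) H -> C1_on (cotangent U) (chi c g H) ->
  (forall y, derivable C y 1) ->
  (forall y, derivable zeta y 1) -> (forall y, 0 <= zeta y) ->
  (forall z z', cotangent U z -> cotangent U z' -> V z z' = V z' z) ->
  (forall z z', cotangent U z -> cotangent U z' ->
    ~ causally_related U g (pos z) (pos z') -> V z z' = 0) ->
  ensemble_average U f V Phi ->
  (forall z, cotangent U z -> bracket (chi c g H) H z = 0) ->
  stationary_metric c U g -> stationary_on c (cotangent U) Phi ->
  (forall z, regular c U g H z -> projector_onto (P z) (Sigma' c g H z)) ->
  (forall z z', Gam z z' = Gam z' z) -> (forall z z', 0 <= Gam z z') ->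
  (forall z z', cotangent U z -> cotangent U z' ->
    xcoord 0 z = xcoord 0 z' ->
    (exists o, is_pair_orbit c tauc U H V z z' o) ->
    is_pair_orbit c tauc U H V z z' (orb z z')) ->
  thermodynamic_equilibrium c U g H (collision c U g H P a Gam) f.
Proof.
move=> H f a _ c0 _ Z0 oU _ HC1 chiC1 dC dzeta zeta0 _ _ _ chiH gst Phist.
move=> Pproj Gsym _ _.
split=> // [z Uz gz|z rz|].
(* This is the commutation of p_0 with H, obtained from the time symmetry of the metric and of
   [Phi]. *)
- have H0 : partial (ix 0) H z = 0.
    apply: (partial_time_hamiltonian oU gst Phist) => //.
      by rewrite gt_eqF.
    by have [] := HC1 z Uz.
  exact: (bracket_f_over_gamma _ Z0 HC1 chiC1 dC dzeta Uz gz (chiH z Uz) H0).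
- exact: (collision_f_eq0 _ Z0 oU HC1 chiC1 dC dzeta zeta0 Pproj).
- exact: f_infty_stationary.
Qed.
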